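(* Let $d\ge 0$ be an integer, let $F$ be a minimum linear forest of a $d$-regular graph $G$, and let $X \subseteq \operatorname{End}(F)$ be a sub-multiset. Then $$|C(F,X)| \ge \frac{d+1}{4}\cdot |\operatorname{End}(F)\setminus X| .$$
   Context: Graphs are finite and simple. A linear forest of a graph $G$ is a subgraph of $G$ that is a collection of vertex-disjoint paths (a single vertex counts as a path); every linear forest is assumed to be spanning, i.e. to contain all vertices of $G$. A minimum linear forest of $G$ is a linear forest with the minimum number of paths (components) among all linear forests of $G$. $\operatorname{End}(F)$ is the multiset of endpoints of the paths of $F$, where an isolated vertex of $F$ is contained twice in $\operatorname{End}(F)$. Inclusion, difference and cardinality of (sub-)multisets of $\operatorname{End}(F)$ are taken with multiplicity. Rotations: Let $F$ be a linear forest of $G$, $v$ an endpoint of $F$, and $u$ a neighbour of $v$ in $G$. If $u$ and $v$ are on the same path of $F$, let $w$ be the neighbour of $u$ on that path that is closer to $v$ (possibly $w=v$). Otherwise, let $w$ be any neighbour of $u$ on its path in $F$ (if $u$ is isolated in $F$ there is no such $w$ and no rotation). The linear forest $F'$ obtained from $F$ by removing the edge $uw$ and adding the edge $uv$ is a rotation of $F$, which rotates the old endpoint $v$ to the new endpoint $w$; then $\operatorname{End}(F')=(\operatorname{End}(F)\setminus\{v\})\cup\{w\}$ as multisets. For a sub-multiset $X\subseteq \operatorname{End}(F)$ (the fixed endpoints), $\mathcal{F}(F,X)$ is the family of all linear forests obtained from $F$ by a (possibly empty) finite sequence of rotations that never rotates an endpoint of $X$; that is, at each step the old endpoint $v$ of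 the rotation of the current forest $F_j$ belongs to the multiset difference $\operatorname{End}(F_j)\setminus X$ (so if $v$ is once in $X$ but twice in $\operatorname{End}(F_j)$, one copy of $v$ may be rotated). Define the set of vertices $$C(F,X) = \bigcup_{F'\in\mathcal{F}(F,X)} \operatorname{End}(F')\setminus X,$$ i.e. the set of vertices occurring in the multiset difference $\operatorname{End}(F')\setminus X$ for some $F'\in\mathcal{F}(F,X)$. *)

(* Defs.v *)
From mathcomp Require Import all_boot all_order all_algebra finmap multiset.
From mathcomp Require Import boolp.

Set Implicit Arguments.
Unset Strict Implicit.
Unset Printing Implicit Defensive.

Section Graphs.

Variables (T : finType) (e : rel T).

Definition simple_graph : Prop := symmetric e /\ irreflexive e.

Definition regular (d : nat) : Prop := forall x, #|[set y | e x y]| = d.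

End Graphs.

Section LinearForests.

Variables (T : finType) (e : rel T).

(* A collection of paths, each path being listed by its successive vertices.
   Distinct lists may represent the same subgraph (reversing or permuting
   paths); subgraphs are compared through their edge sets [edges F]. *)
Definition path_system : Type := seq (seq T).

Implicit Types (F : path_system) (p : seq T) (X : {mset T}%mset).

(* [perm_eq (flatten F) (enum T)] says that every vertex of the graph occurs
   exactly once: the paths are simple, pairwise disjoint, and spanning. *)
Definition linear_forest F : bool :=
  all (fun p => (p != [::]) && sorted e p) F && perm_eq (flatten F) (enum T).

Definition min_linear_forest F : Prop :=
  linear_forest F /\ forall F', linear_forest F' -> size F <= size F'.

Definition adj F (x y : T) : bool :=
  has (fun p => infix [:: x; y] p || infix [:: y; x] p) F.

Definition edges F : {set {set T}} :=
  [set [set xy.1; xy.2] | xy : T * T & adj F xy.1 xy.2].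

(* A one-vertex path [:: x] contributes x twice. *)
Definition path_ends p : seq T :=
  if p is x :: q then [:: x; last x q] else [::].

Definition End F : {mset T}%mset := seq_mset (flatten (map path_ends F)).

(* Distance along the path p, for vertices of p. *)
Definition path_dist p (x y : T) : nat := `|index x p - index y p|%N.

(* [rotation F v w F']: F' is a rotation of F, with old endpoint v and new
   endpoint w. *)
Definition rotation F (v w : T) F' : Prop :=
  exists u : T,
    [/\ v \in End F, e v u, adj F u w,
        (forall p, p \in F -> u \in p -> v \in p ->
           path_dist p w v < path_dist p u v)
      & linear_forest F' /\
        edges F' = [set u; v] |: (edges F :\ [set u; w])].

(* The family F(F, X). *)
Inductive rotations F X : path_system -> Prop :=
| rotations_refl : rotations F X F
| rotations_step F1 v w F2 :
    rotations F X F1 -> v \in (End F1 `\` X)%mset -> rotation F1 v w F2 ->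
    rotations F X F2.

Definition C F X : {set T} :=
  [set x | `[< exists2 F', rotations F X F' & x \in (End F' `\` X)%mset >]].

End LinearForests.

(* Main.v *)
Require Import Defs.
From mathcomp Require Import all_boot all_order all_algebra finmap multiset.
From mathcomp Require Import boolp zify.

(** Write K for C(F, X), k for the size of End(F) \ X, and call an endpoint of
a reachable forest G free if it occurs in End(G) \ X.  For a vertex u let
[cdeg u] be the number of its graph neighbours in K, and [fdeg G u] the number
of its G-neighbours in K.  The claim (d + 1) k <= 4 |K| is proved by strong
induction on k; suppose that it fails for F and X.

Fixing further endpoints.  If G is reachable and l > 0 further endpoints of G
are added to X, the claim holds by induction for G and the larger multiset Y,
and C(G, Y) is a subset of K.  Hence a set N of vertices of K which is disjoint
from C(G, Y) has 4 |N| < l (d + 1) (lemma [drop]).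

Pivots.  A free endpoint v adjacent to u can be rotated with pivot u, so
[fdeg G u] > 0; if two free endpoints are adjacent to u, both G-neighbours of u
can become endpoints, so u is not an endpoint and [fdeg G u] = 2.  Moreover a
rotation changes [fdeg _ z] only when z is its old or its new endpoint.  With
N the set of graph neighbours of u in K, this bounds [cdeg u]:
- if u is not in K, then [fdeg _ u] is invariant; if it is 1, at most one free
  endpoint is adjacent to u, and fixing it gives 4 [cdeg u] <= d.  In all cases
  2 [cdeg u] <= d [fdeg F u] ([cdeg_outside]);
- if u is in K, make u an endpoint; fixing it, and another endpoint adjacent to
  it if one is reachable, gives 2 [cdeg u] <= d ([cdeg_inside]);
- let x in K be K-isolated, i.e. [fdeg F x] = 0.  The rotations that lead to a
  free neighbour of x must first make x itself free, and until then they
  preserve [fdeg] on the neighbours of x in K ([fdeg_isolated]).  Hence two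
  K-isolated vertices are never adjacent.  Fixing x at that moment gives
  4 [cdeg v] <= d for every v in K adjacent to x with [fdeg F v] = 1
  ([cdeg_isolated_nbr]).

Counting.  Charge the edges between the K-isolated vertices and K to their other
ends.  The bounds above then add up to 2 sum [cdeg u] <= d sum [fdeg F u]
([sum_cdeg_le]).  The left-hand side is 2 d |K| by regularity.  Since every
vertex u has degree 2 - mult(u) in F, where mult(u) is its multiplicity in
End(F), the right-hand side is at most d (2 |K| - k), a contradiction when
d > 0.  For d = 0 the same degree formula gives k <= 2 |K|. *)

Set Implicit Arguments.
Unset Strict Implicit.
Unset Printing Implicit Defensive.

(** * Edges and degrees of a path system *)

Lemma eq_set2 (T : finType) (x y a b : T) :
  ([set x; y] == [set a; b]) = (x == a) && (y == b) || (x == b) && (y == a).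
Proof.
apply/eqP/idP => [E|/orP[]/andP[/eqP-> /eqP->] //]; last by rewrite setUC.
have xE : x \in [set a; b] by rewrite -E set21.
have yE : y \in [set a; b] by rewrite -E set22.
have aE : a \in [set x; y] by rewrite E set21.
have bE : b \in [set x; y] by rewrite E set22.
move: xE yE aE bE; rewrite !inE => /orP[]/eqP-> /orP[]/eqP->;
  rewrite ?eqxx ?orbT //.
- by rewrite !orbb => _ /eqP->; rewrite eqxx.
- by rewrite !orbb => /eqP->; rewrite eqxx.
Qed.

Lemma index_rev_uniq (T : eqType) (p : seq T) (x : T) :
  uniq p -> x \in p -> index x (rev p) = size p - (index x p).+1.
Proof.
move=> up xp; have lt : index x p < size p by rewrite index_mem.
rewrite -{1}(nth_index x xp).
have -> : nth x p (index x p) = nth x (rev p) (size p - (index x p).+1).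
  rewrite nth_rev; last by lia.
  by congr nth; lia.
by rewrite index_uniq ?rev_uniq ?size_rev //; lia.
Qed.

Lemma absz_rev (m n k : nat) : m < k -> n < k ->
  `|((k - m.+1)%:Z - (k - n.+1)%:Z)%R|%N = `|(m%:Z - n%:Z)%R|%N.
Proof. lia. Qed.

Section PathEdges.

Variable T : finType.
Implicit Types (p q s t : seq T) (F G : path_system T) (x y u v w : T).

(** The edges of a path, as two-element sets, in the order in which the path
    traverses them. *)
Definition path_edges p : seq {set T} :=
  if p is x :: q then pairmap (fun a b => [set a; b]) x q else [::].

(** All edges of a path system, as a list: in a linear forest each occurs once. *)
Definition forest_edges F : seq {set T} := flatten (map path_edges F).

Lemma path_edges_cat s x y t :
  path_edges (rcons s x ++ y :: t) =
  path_edges (rcons s x) ++ [set x; y] :: path_edges (y :: t).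
Proof.
by case: s => [|a s] //=; rewrite pairmap_cat last_rcons.
Qed.

Lemma path_edges_rev p : path_edges (rev p) =i path_edges p.
Proof.
elim: p => [|x [|y p] IH] //= E; rewrite rev_cons.
have -> : rcons (rev (y :: p)) x = rcons (rev p) y ++ [:: x].
  by rewrite rev_cons cats1.
by rewrite path_edges_cat mem_cat -rev_cons IH !inE orbC setUC.
Qed.

Lemma path_edges_sub p E x : E \in path_edges p -> x \in E -> x \in p.
Proof.
elim: p => [|y [|z p] IH] //=; rewrite inE => /orP[/eqP->|Ep xE].
  by rewrite !inE => /orP[]->; rewrite ?orbT.
by rewrite inE IH ?orbT.
Qed.

Lemma path_edges_pair p E :
  E \in path_edges p -> exists xy, E = [set xy.1; xy.2].
Proof.
elim: p => [|y [|z p] IH] //=; rewrite inE => /orP[/eqP->|/IH//].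
by exists (y, z).
Qed.

Lemma infix_path_edges p x y :
  (infix [:: x; y] p || infix [:: y; x] p) = ([set x; y] \in path_edges p).
Proof.
elim: p => [|a [|b p] IH] //=; first by rewrite !andbF.
rewrite inE -IH eq_set2 /= !prefix0s !andbT.
case: (x == a) (x == b) (y == a) (y == b) => [] [] [] [] //=;
  by rewrite ?orbT ?orbF.
Qed.

Lemma adjE F x y : adj F x y = ([set x; y] \in forest_edges F).
Proof.
rewrite /forest_edges /adj; elim: F => //= p F ->.
by rewrite mem_cat infix_path_edges.
Qed.

Lemma adj_sym F x y : adj F x y = adj F y x.
Proof. by rewrite !adjE setUC. Qed.

Lemma edgesE F E : (E \in edges F) = (E \in forest_edges F).
Proof.
apply/imsetP/idP => [[xy]|EF]; first by rewrite inE adjE => H ->.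
have [xy E2] : exists xy, E = [set xy.1; xy.2].
  by move/flattenP: EF => [s /mapP[p _ ->]] /path_edges_pair.
by exists xy; rewrite // inE adjE -E2.
Qed.

Lemma adj_edges F x y : adj F x y = ([set x; y] \in edges F).
Proof. by rewrite edgesE adjE. Qed.

Lemma forest_edges_sub F E x : E \in forest_edges F -> x \in E -> x \in flatten F.
Proof.
move/flattenP => [s /mapP[p pF ->]] Ep xE.
by apply/flattenP; exists p => //; apply: path_edges_sub xE.
Qed.

Lemma path_edges_uniq p : uniq p -> uniq (path_edges p).
Proof.
elim: p => [|x [|y p] IH] //= /andP[xp up]; rewrite IH // andbT.
by apply: contra xp => /(@path_edges_sub (y :: p)) -> //; rewrite set21.
Qed.

Lemma forest_edges_uniq F : uniq (flatten F) -> uniq (forest_edges F).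
Proof.
elim: F => //= p F IH; rewrite cat_uniq => /and3P[up /hasPn pF uF].
rewrite cat_uniq path_edges_uniq //= IH // andbT.
apply/hasPn => E EF; apply/negP => /= Ep.
have [xy E2] := path_edges_pair Ep.
have xE : xy.1 \in E by rewrite E2 set21.
by have /pF/negP := forest_edges_sub EF xE; apply; apply: path_edges_sub xE.
Qed.

(** Handshake count at x along one path: each occurrence of x as an end makes
    up for one missing edge, and a one-vertex path has its vertex twice as an end. *)
Lemma path_edges_count p x : uniq p ->
  count (fun E : {set T} => x \in E) (path_edges p) + count_mem x (path_ends p)
    = 2 * (x \in p).
Proof.
elim: p => [|a [|b p] IH] //.
  by rewrite /= !inE [x == a]eq_sym; case: eqP.
rewrite cons_uniq => /andP[ap /IH {}IH]; rewrite [x \in _ :: _]inE.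
move: IH; rewrite /= !inE [x == a]eq_sym [x == b]eq_sym.
move: ap; rewrite inE negb_or => /andP[/negPf ab /negPf ap].
case: (a =P x) ab ap => [->|_] /=; last first.
  by move=> _ _ <-; rewrite add0n [_ + count _ _]addnC -!addnA.
move=> xb xp; rewrite [b == x]eq_sym xb xp /=.
by case: (_ == _) => /= H; move: H; rewrite muln0 => /eqP; rewrite ?addn_eq0 => /andP[/eqP->].
Qed.

Lemma forest_edges_count F x : uniq (flatten F) ->
  count (fun E : {set T} => x \in E) (forest_edges F) + End F x
    = 2 * (x \in flatten F).
Proof.
rewrite /End mset_seqE /forest_edges; elim: F => //= p F IH.
rewrite cat_uniq => /and3P[up /hasPn pF uF].
rewrite !count_cat mem_cat addnACA path_edges_count // IH // -mulnDr.
by have := pF x; case: (x \in flatten F) => [/(_ isT) /negPf->|_]; rewrite ?orbF ?addn0.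
Qed.

(** The neighbours of x in the path system F (in a linear forest at most two). *)
Definition nbrs F x := [set y | adj F x y].

Lemma in_nbrs F x y : (y \in nbrs F x) = adj F x y.
Proof. by rewrite inE. Qed.

Lemma card_nbrs F x : uniq (flatten F) ->
  #|nbrs F x| = count (fun E : {set T} => x \in E) (forest_edges F).
Proof.
move=> uF; rewrite -size_filter cardE.
rewrite -(size_map (fun y => [set x; y])); apply/perm_size/uniq_perm.
- rewrite map_inj_uniq ?enum_uniq // => y z /eqP; rewrite eq_set2 eqxx /=.
  by case/orP => [/eqP|/andP[/eqP-> /eqP->]].
- by rewrite filter_uniq // forest_edges_uniq.
move=> E; rewrite mem_filter; apply/mapP/andP => [[y]|[xE EF]].
  by rewrite mem_enum in_nbrs adjE => yF ->; rewrite set21.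
move/flattenP: (EF) => [s /mapP[p _ ->]] /path_edges_pair[[a b] /= E2].
move: xE; rewrite E2 !inE => /orP[]/eqP xE.
  by exists b; rewrite ?mem_enum ?in_nbrs ?adjE xE // -E2.
by exists a; rewrite ?mem_enum ?in_nbrs ?adjE xE setUC // -E2.
Qed.

Lemma path_uniq F p q x : uniq (flatten F) ->
  p \in F -> q \in F -> x \in p -> x \in q -> p = q.
Proof.
elim: F => //= r F IH; rewrite cat_uniq => /and3P[_ /hasPn rF uF].
rewrite !inE => /orP[/eqP->|pF] /orP[/eqP->|qF] xp xq //.
- by have /rF/negP[] : x \in flatten F by apply/flattenP; exists q.
- by have /rF/negP[] : x \in flatten F by apply/flattenP; exists p.
- exact: IH.
Qed.

Lemma path_dist_rev p x y : uniq p -> x \in p -> y \in p ->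
  path_dist (rev p) x y = path_dist p x y.
Proof.
move=> up xp yp; rewrite /path_dist !index_rev_uniq //.
by move: xp yp; rewrite -!index_mem; apply: absz_rev.
Qed.

Lemma End_path F v : v \in End F -> exists2 p, p \in F & v \in path_ends p.
Proof.
rewrite in_mset /End mset_seqE -has_count has_pred1.
by move/flattenP => [s /mapP[p pF ->]]; exists p.
Qed.

(** A path with end v can be traversed from v. *)
Lemma path_ends_orient p v : v \in path_ends p ->
  exists q, v :: q = p \/ v :: q = rev p.
Proof.
case: p => //= x q; rewrite !inE => /orP[]/eqP->; first by exists q; left.
case/lastP: q => [|q y]; first by exists [::]; left.
by exists (rev (x :: q)); right; rewrite last_rcons -rcons_cons rev_rcons.
Qed.

End PathEdges.

(** * Rerouting linear forests *)

Section Rotations.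

Variables (T : finType) (e : rel T).
Hypotheses (sym_e : symmetric e) (irr_e : irreflexive e).
Implicit Types (p q s t : seq T) (F G : path_system T) (x y u v w : T).

Lemma linear_forest_uniq F : linear_forest e F -> uniq (flatten F).
Proof. by case/andP => _ /perm_uniq->; rewrite enum_uniq. Qed.

Lemma linear_forest_mem F x : linear_forest e F -> x \in flatten F.
Proof. by case/andP => _ /perm_mem->; rewrite mem_enum. Qed.

(** The multiplicity of x as an endpoint is its degree deficit. *)
Lemma degree_End F x : linear_forest e F -> #|nbrs F x| + End F x = 2.
Proof.
move=> lF; have uF := linear_forest_uniq lF.
by rewrite card_nbrs // forest_edges_count // linear_forest_mem.
Qed.

Lemma size_End F : linear_forest e F -> size (End F) = 2 * size F.
Proof.
move=> lF; rewrite /End (perm_size (perm_eq_seq_mset _)).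
case/andP: lF => /allP Fe _; elim: F Fe => //= -[|x p] F IH Fe.
  by have := Fe [::]; rewrite inE eqxx => /(_ isT).
rewrite /= IH ?mulnS ?add2n // => q qF; apply: Fe.
by rewrite inE qF orbT.
Qed.

Lemma path_edges_adj p a b : sorted e p -> [set a; b] \in path_edges p -> e a b.
Proof.
elim: p => [|x [|y p] IH] //= /andP[xy /IH{}IH]; rewrite inE => /orP[|//].
by rewrite eq_set2 => /orP[]/andP[/eqP-> /eqP->]; rewrite // sym_e.
Qed.

Lemma adj_e F x y : linear_forest e F -> adj F x y -> e x y.
Proof.
case/andP => /allP Fe _; rewrite adjE => /flattenP[s /mapP[p pF ->]].
by apply: path_edges_adj; case/andP: (Fe p pF).
Qed.

Lemma nbrs_irr F x : linear_forest e F -> x \notin nbrs F x.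
Proof. by move=> lF; rewrite in_nbrs; apply/negP => /(adj_e lF); rewrite irr_e. Qed.

Lemma sorted_revE p : sorted e (rev p) = sorted e p.
Proof. by rewrite rev_sorted; apply: eq_sorted => x y; rewrite sym_e. Qed.

(** G is a linear forest if F is, with as many paths and the same edges; in
    the uses below G lists the paths of F in another order or backwards. *)
Definition redraw F G := [/\ linear_forest e F -> linear_forest e G,
  size G = size F & forest_edges G =i forest_edges F].

Lemma redraw_trans F G H : redraw F G -> redraw G H -> redraw F H.
Proof.
move=> [l1 s1 e1] [l2 s2 e2]; split; [by move/l1/l2 | by rewrite s2 |].
by move=> E; rewrite e2.
Qed.

Lemma redraw_perm F G : perm_eq G F -> redraw F G.
Proof.
move=> FG; split; last 2 first.
- exact: perm_size.
- by apply: perm_mem; apply: perm_flatten; apply: perm_map.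
case/andP => Fe FT; rewrite /linear_forest (perm_all _ FG) Fe.
by rewrite (perm_trans (perm_flatten FG)).
Qed.

Lemma redraw_rev p F : redraw (p :: F) (rev p :: F).
Proof.
split=> //; last first.
  by move=> E; rewrite /forest_edges /= !mem_cat path_edges_rev.
rewrite /linear_forest /= => /andP[/andP[/andP[p0 ep] ->] /= pF].
rewrite sorted_revE ep -size_eq0 size_rev size_eq0 p0 /=.
by apply: perm_trans pF; rewrite perm_cat2r perm_rev.
Qed.

Lemma redraw_front p F : p \in F -> redraw F (p :: rem p F).
Proof. by move=> pF; apply: redraw_perm; rewrite perm_sym perm_to_rem. Qed.

Lemma redraw_front2 p q F : q \in F -> redraw (p :: F) (q :: p :: rem q F).
Proof.
move=> qF; apply: redraw_perm.
by rewrite (perm_catCA [:: q] [:: p] (rem q F)) perm_cons perm_sym perm_to_rem.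
Qed.

Lemma redraw_adj F G x y : redraw F G -> adj G x y = adj F x y.
Proof. by case=> _ _ E; rewrite !adjE E. Qed.

Lemma redraw_edges F G : redraw F G -> edges G = edges F.
Proof. by case=> _ _ E; apply/setP => A; rewrite !edgesE E. Qed.

Lemma sorted_cat_rcons s x y t :
  sorted e (rcons s x ++ y :: t) =
  [&& sorted e (rcons s x), e x y & sorted e (y :: t)].
Proof. by case: s => [|a s] //=; rewrite cat_path last_rcons. Qed.

Lemma rev_rcons_ex s v w q :
  rcons s w = v :: q -> exists s', rev (rcons s w) = rcons s' v.
Proof. by move->; exists (rev q); rewrite rev_cons. Qed.

(** Replacing one occurrence of x by y in the list of edges. *)
Lemma edges_exchange F G A A' B B' (x y : {set T}) :
  uniq (flatten F) ->
  forest_edges F = A ++ x :: B -> forest_edges G = A' ++ y :: B' ->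
  A' ++ B' =i A ++ B -> edges G = y |: (edges F :\ x).
Proof.
move=> uF EF EG AB; have := forest_edges_uniq uF.
rewrite EF (perm_uniq (permEl (perm_catCA A [:: x] B))) /= => /andP[xAB _].
have AB' E : (E \in A') || (E \in B') = (E \in A) || (E \in B).
  by have := AB E; rewrite !mem_cat.
apply/setP => E; rewrite !inE !edgesE EF EG !mem_cat !inE orbCA AB'.
rewrite mem_cat in xAB; case: (E =P x) => [->|_] /=.
  by rewrite (negPf xAB) orbF.
by [].
Qed.

(** Rotation of the end v of the path v ... w u t when the pivot u lies on the
    same path: the initial segment v ... w is reversed. *)
Lemma reroute_same s w u t G v q :
  linear_forest e ((rcons s w ++ u :: t) :: G) -> rcons s w = v :: q -> e v u ->
  let F' := (rev (rcons s w) ++ u :: t) :: G in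
  linear_forest e F' /\
  edges F' = [set u; v] |: (edges ((rcons s w ++ u :: t) :: G) :\ [set u; w]).
Proof.
move=> lF sv vu F'; have uF := linear_forest_uniq lF.
have [s' Es'] := rev_rcons_ex sv; split.
  have [/(_ lF)] := redraw_rev (rcons s w ++ u :: t) G.
  move: lF => /andP[/= /andP[/andP[_ +] GE] FT] _ _ _.
  rewrite sorted_cat_rcons => /and3P[es wu et].
  rewrite /linear_forest /= GE Es' sorted_cat_rcons vu et -Es'.
  rewrite sorted_revE es andbT.
  apply/andP; split; first by rewrite Es'; case: (s').
  by apply: perm_trans FT; rewrite -!catA perm_cat2r perm_rev.
apply: (@edges_exchange _ _ (path_edges (rcons s w)) (path_edges (rcons s' v))
  (path_edges (u :: t) ++ forest_edges G) (path_edges (u :: t) ++ forest_edges G)) => //.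
- by rewrite /forest_edges /= path_edges_cat -catA /= [[set w; u]]setUC.
- by rewrite /forest_edges /= Es' path_edges_cat -catA /= [[set v; u]]setUC.
- by move=> E; rewrite !mem_cat -Es' path_edges_rev.
Qed.

(** Rotation of the end v of the path v q when the pivot u lies on another path
    s w u t: the tail from u on is cut off and attached to v. *)
Lemma reroute_other s w u t v q G :
  linear_forest e ((rcons s w ++ u :: t) :: (v :: q) :: G) -> e v u ->
  let F' := rcons s w :: (rev (v :: q) ++ u :: t) :: G in
  linear_forest e F' /\
  edges F' = [set u; v] |:
    (edges ((rcons s w ++ u :: t) :: (v :: q) :: G) :\ [set u; w]).
Proof.
move=> lF vu F'; have uF := linear_forest_uniq lF.
have Ev := rev_cons v q; split.
  move: lF; rewrite /linear_forest /= sorted_cat_rcons.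
  case/andP => /and3P[/andP[_ /and3P[es wu et]] eq GE] FT.
  rewrite es GE Ev sorted_cat_rcons vu et -Ev sorted_revE [sorted _ _]eq andbT.
  apply/andP; split; first by rewrite Ev; case: (s) => //=; case: (rev q).
  apply: perm_trans FT; rewrite -!catA perm_cat2l -cat_cons perm_catCA.
  by rewrite perm_cat2l perm_cat2r perm_rev.
apply: (@edges_exchange _ _ (path_edges (rcons s w))
  (path_edges (rcons s w) ++ path_edges (rcons (rev q) v))
  (path_edges (u :: t) ++ path_edges (v :: q) ++ forest_edges G)
  (path_edges (u :: t) ++ forest_edges G)) => //.
- by rewrite /forest_edges /= path_edges_cat -catA /= [[set w; u]]setUC.
- by rewrite /forest_edges /= Ev path_edges_cat -!catA /= [[set v; u]]setUC.
- move=> E; rewrite !mem_cat -Ev path_edges_rev.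
  by case: (E \in path_edges (rcons s w)) => //=; rewrite orbCA.
Qed.

Lemma merge_paths u t v q G :
  linear_forest e ((u :: t) :: (v :: q) :: G) -> e v u ->
  linear_forest e ((rev (v :: q) ++ u :: t) :: G).
Proof.
have Ev := rev_cons v q => + vu.
rewrite /linear_forest /= => /andP[/and3P[et eq GE] FT].
rewrite GE Ev sorted_cat_rcons vu [sorted _ (u :: t)]et -Ev sorted_revE [sorted _ _]eq.
rewrite !andbT; apply/andP; split; first by rewrite Ev; case: (rev q).
apply: perm_trans FT; rewrite -catA perm_catCA -[u :: t ++ _]cat_cons.
by rewrite perm_cat2l -[v :: q ++ _]cat_cons perm_cat2r perm_rev.
Qed.

Lemma redraw_end F p v : p \in F -> v \in path_ends p ->
  exists2 q, v :: q = p \/ v :: q = rev p & redraw F ((v :: q) :: rem p F).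
Proof.
move=> pF /path_ends_orient[q pq]; exists q => //.
apply: redraw_trans (redraw_front pF) _.
by case: pq => ->; [apply: redraw_perm | apply: redraw_rev].
Qed.

Lemma path_ends_sub p v : v \in path_ends p -> v \in p.
Proof. by case: p => //= x q; rewrite !inE => /orP[->//|/eqP->]; rewrite -in_cons mem_last. Qed.

Lemma mem_End F p v : p \in F -> v \in path_ends p -> v \in End F.
Proof.
move=> pF vp; rewrite in_mset /End mset_seqE -has_count has_pred1.
by apply/flattenP; exists (path_ends p) => //; apply: map_f.
Qed.

Lemma path_edge_split p u w : [set u; w] \in path_edges p ->
  exists s t, rcons s w ++ u :: t = p \/ rcons s w ++ u :: t = rev p.
Proof.
rewrite -infix_path_edges => /orP[]/infixP[s [t ->]].
  exists (rev t), (rev s); right.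
  by rewrite !rev_cat -cat_rcons /= rev_cons rev_cons -!cats1 -!catA.
by exists s, t; left; rewrite cat_rcons.
Qed.

(** On the path of v, the new endpoint w is the neighbour of u nearer to v. *)
Lemma rotate_same_path F p u v :
  linear_forest e F -> p \in F -> v \in path_ends p -> u \in p -> e v u ->
  exists w F', [/\ rotation e F v w F', adj F u w &
                  path_dist p w v < path_dist p u v].
Proof.
move=> lF pF vp up vu; have uF := linear_forest_uniq lF.
have [q pq rF] := redraw_end pF vp.
have lF0 : linear_forest e ((v :: q) :: rem p F) by case: rF => /(_ lF).
have uq : u \in q.
  have : u \in v :: q by case: pq => ->; rewrite ?mem_rev.
  by rewrite inE => /orP[/eqP uv|//]; rewrite uv irr_e in vu.
case/splitPr: uq rF lF0 pq => q1 q2; rewrite -cat_cons.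
case/lastP E: (v :: q1) => [//|s w] rF lF0 pq.
have [lF' EF'] := reroute_same lF0 (esym E) vu.
have Ap x : (x \in p) = (x \in rcons s w ++ u :: q2).
  by case: pq => ->; rewrite ?mem_rev.
have wp : w \in p by rewrite Ap mem_cat mem_rcons mem_head.
have upp : uniq p.
  by have := linear_forest_uniq lF0; rewrite /= cat_uniq; case: pq => ->;
     rewrite ?rev_uniq => /and3P[].
have dp x y : x \in p -> y \in p ->
    path_dist p x y = path_dist (rcons s w ++ u :: q2) x y.
  by move=> xp yp; case: pq => [->//|->]; rewrite path_dist_rev.
have vpp := path_ends_sub vp.
have dist : path_dist p w v < path_dist p u v.
  rewrite !dp // /path_dist.
  have := upp; have -> : uniq p = uniq (rcons s w ++ u :: q2).
    by case: pq => ->; rewrite ?rev_uniq.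
  rewrite cat_uniq rcons_uniq => /and3P[/andP[ws _] /hasPn us _].
  have {}us : u \notin rcons s w by apply: us; rewrite mem_head.
  have v0 : index v (rcons s w) = 0 by rewrite -E /= eqxx.
  have iw : index w (rcons s w) = size s.
    by rewrite -cats1 index_cat (negPf ws) /= eqxx addn0.
  have vs : v \in rcons s w by rewrite -E mem_head.
  rewrite !index_cat (negPf us) vs v0 mem_rcons mem_head iw /= eqxx size_rcons.
  by rewrite addn0; lia.
have adjuw : adj F u w.
  rewrite -(redraw_adj _ _ rF) adjE /forest_edges /= path_edges_cat.
  by rewrite !mem_cat inE [[set w; u]]setUC eqxx !orbT.
exists w, ((rev (rcons s w) ++ u :: q2) :: rem p F); split=> //.
exists u; split=> //; first exact: mem_End vp.
  by move=> p1 p1F up1 _; rewrite -(path_uniq uF pF p1F up up1).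
by rewrite EF' (redraw_edges rF).
Qed.

Lemma rotate_other_path F p u v w :
  linear_forest e F -> p \in F -> v \in path_ends p -> u \notin p -> e v u ->
  adj F u w -> exists F', rotation e F v w F'.
Proof.
move=> lF pF vp up vu uw; have uF := linear_forest_uniq lF.
have [q pq rF] := redraw_end pF vp.
move: (uw); rewrite adjE => /flattenP[s0 /mapP[p2 p2F ->]] uwp2.
have up2 : u \in p2 by apply: path_edges_sub uwp2 _; rewrite set21.
have p2G : p2 \in rem p F.
  have /perm_mem/(_ p2) := perm_to_rem pF; rewrite p2F inE.
  by case: eqP => // E; rewrite -E up2 in up.
have [s [t st]] := path_edge_split uwp2.
have rF2 : redraw F ((rcons s w ++ u :: t) :: (v :: q) :: rem p2 (rem p F)).
  apply: redraw_trans rF _; apply: redraw_trans (redraw_front2 _ p2G) _.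
  by case: st => ->; [apply: redraw_perm | apply: redraw_rev].
have [lF' EF'] := reroute_other (let: And3 l _ _ := rF2 in l lF) vu.
exists (rcons s w :: (rev (v :: q) ++ u :: t) :: rem p2 (rem p F)), u; split=> //.
- exact: mem_End vp.
- move=> p1 p1F up1 vp1; case/negP: up.
  by rewrite (path_uniq uF pF p1F (path_ends_sub vp) vp1).
- by rewrite EF' (redraw_edges rF2).
Qed.

(** In a minimum forest the ends of different paths are not adjacent, since an
    edge between them would merge the two paths. *)
Lemma min_ends_nonadjacent F p u v :
  min_linear_forest e F -> p \in F -> v \in path_ends p -> u \notin p ->
  e v u -> u \notin End F.
Proof.
move=> [lF minF] pF vp up vu; apply/negP => /End_path[p2 p2F up2].
have [q pq rF] := redraw_end pF vp.
have p2G : p2 \in rem p F.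
  have /perm_mem/(_ p2) := perm_to_rem pF; rewrite p2F inE.
  by case: eqP => // E; rewrite -E (path_ends_sub up2) in up.
have [t pt] := path_ends_orient up2.
have rF2 : redraw F ((u :: t) :: (v :: q) :: rem p2 (rem p F)).
  apply: redraw_trans rF _; apply: redraw_trans (redraw_front2 _ p2G) _.
  by case: pt => ->; [apply: redraw_perm | apply: redraw_rev].
have [l s _] := rF2.
by have := minF _ (merge_paths (l lF) vu); rewrite -s /= ltnn.
Qed.

Lemma end_degree_gt0 F p u v :
  linear_forest e F -> p \in F -> v \in path_ends p -> u \in p -> u != v ->
  0 < #|nbrs F v|.
Proof.
move=> lF pF vp up uv; have [q pq rF] := redraw_end pF vp.
have : u \in v :: q by case: pq => ->; rewrite ?mem_rev.
rewrite inE (negPf uv) /= => uq.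
case: q uq rF pq => // c q _ rF _; apply/card_gt0P; exists c.
by rewrite in_nbrs -(redraw_adj _ _ rF) adjE /forest_edges /= mem_head.
Qed.

Lemma path_ends_index p v : uniq p -> v \in path_ends p ->
  index v p = 0 \/ index v p = (size p).-1.
Proof.
case: p => // x q uq; rewrite /path_ends !inE => /orP[]/eqP->.
  by left; rewrite /= eqxx.
by right; rewrite index_last.
Qed.

(** No vertex of a path is closer than u to both ends. *)
Lemma ends_strictly_between p x y u w :
  uniq p -> x \in path_ends p -> y \in path_ends p -> x != y -> u \in p ->
  path_dist p w x < path_dist p u x -> path_dist p w y < path_dist p u y ->
  False.
Proof.
move=> up xp yp xy; rewrite -index_mem /path_dist.
have nxy : index x p <> index y p.
  by move=> E; case/eqP: xy; rewrite -(nth_index x (path_ends_sub xp)) E nth_index // path_ends_sub.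
have := path_ends_index up xp; have := path_ends_index up yp; move: nxy.
move: (index x p) (index y p) (index u p) (index w p) (size p); lia.
Qed.

Lemma non_end_degree F u : linear_forest e F -> u \notin End F -> #|nbrs F u| = 2.
Proof. by move=> lF /mset_eq0P E; have := degree_End u lF; rewrite E addn0. Qed.

Lemma rotate_end F u v : min_linear_forest e F -> v \in End F -> e v u ->
  exists w F', rotation e F v w F' /\ adj F u w.
Proof.
move=> mF vE vu; have [lF _] := mF; have [p pF vp] := End_path vE.
have [up|up] := boolP (u \in p).
  by have [w [F' [rot uw _]]] := rotate_same_path lF pF vp up vu; exists w, F'.
have := non_end_degree lF (min_ends_nonadjacent mF pF vp up vu).
case: (set_0Vmem (nbrs F u)) => [->|[w]]; first by rewrite cards0.
rewrite in_nbrs => uw _; exists w.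
by have [F' rot] := rotate_other_path lF pF vp up vu uw; exists F'.
Qed.

(** Two endpoints adjacent to u, possibly the two copies of one isolated vertex:
    if one of them lies on another path than u it can be rotated to both
    neighbours of u; otherwise they are the two ends of the path of u, and they
    rotate to different neighbours of u. *)
Lemma rotate_two_ends F u x y : min_linear_forest e F ->
  0 < End F x -> 0 < End F y -> (x = y -> 1 < End F x) -> e x u -> e y u ->
  #|nbrs F u| = 2 /\
  forall w, adj F u w -> exists z F', z \in [:: x; y] /\ rotation e F z w F'.
Proof.
move=> mF; rewrite !mset_gt0 => xE yE xyE xu yu.
have [lF _] := mF; have uF := linear_forest_uniq lF.
have [p pF xp] := End_path xE; have [p2 p2F yp2] := End_path yE.
have [up|up] := boolP (u \in p); last first.
  split; first exact: non_end_degree (min_ends_nonadjacent mF pF xp up xu).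
  move=> w uw; have [F' rot] := rotate_other_path lF pF xp up xu uw.
  by exists x, F'; rewrite mem_head.
have [up2|up2] := boolP (u \in p2); last first.
  split; first exact: non_end_degree (min_ends_nonadjacent mF p2F yp2 up2 yu).
  move=> w uw; have [F' rot] := rotate_other_path lF p2F yp2 up2 yu uw.
  by exists y, F'; rewrite !inE eqxx orbT.
have E := path_uniq uF pF p2F up up2; rewrite -E in yp2.
have unx : u != x by apply: contraTneq xu => ->; rewrite irr_e.
have [xy|xy] := eqVneq x y.
  have := degree_End x lF; have := end_degree_gt0 lF pF xp up unx.
  by have := xyE xy; lia.
have [w1 [F1 [rot1 uw1 d1]]] := rotate_same_path lF pF xp up xu.
have [w2 [F2 [rot2 uw2 d2]]] := rotate_same_path lF pF yp2 up yu.
have upp : uniq p.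
  by move/perm_flatten/perm_uniq: (perm_to_rem pF); rewrite uF /= cat_uniq => /esym/and3P[].
have w12 : w1 != w2.
  apply/eqP => w12; rewrite -w12 in d2.
  exact: ends_strictly_between upp xp yp2 xy up d1 d2.
have sub : [set w1; w2] \subset nbrs F u.
  by apply/subsetP => w; rewrite !inE => /orP[]/eqP->.
have le2 : #|nbrs F u| <= #|[set w1; w2]|.
  by rewrite cards2 w12 -(degree_End u lF) leq_addr.
have Enb : [set w1; w2] = nbrs F u by apply/eqP; rewrite eqEcard sub.
split; first by rewrite -Enb cards2 w12.
move=> w; rewrite -in_nbrs -Enb !inE => /orP[]/eqP->.
  by exists x, F1; rewrite mem_head.
by exists y, F2; rewrite !inE eqxx orbT.
Qed.

Lemma adj_path_dist F u v : linear_forest e F -> adj F u v ->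
  exists p, [/\ p \in F, u \in p, v \in p & path_dist p u v = 1].
Proof.
move=> lF; rewrite adjE => /flattenP[s0 /mapP[p pF ->]] Ep.
have vp : v \in p by apply: path_edges_sub Ep _; rewrite set22.
have up : u \in p by apply: path_edges_sub Ep _; rewrite set21.
exists p; split=> //.
have upp : uniq p.
  move/perm_flatten/perm_uniq: (perm_to_rem pF).
  by rewrite (linear_forest_uniq lF) /= cat_uniq => /esym/and3P[].
have [s [t st]] := path_edge_split Ep.
have -> : path_dist p u v = path_dist (rcons s v ++ u :: t) u v.
  by case: st => ->; rewrite ?path_dist_rev.
have : uniq (rcons s v ++ u :: t) by case: st => ->; rewrite ?rev_uniq.
rewrite cat_uniq rcons_uniq => /and3P[/andP[vs _] /hasPn us _].
have {}us : u \notin rcons s v by apply: us; rewrite mem_head.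
rewrite /path_dist !index_cat (negPf us) mem_rcons mem_head /= eqxx size_rcons.
by rewrite -cats1 index_cat (negPf vs) /= eqxx; lia.
Qed.

(** The pivot u of a rotation is not adjacent to v in F unless w = v: the only
    F-neighbour of v is on its path at distance 1, which leaves w = v. *)
Lemma rotation_effect F v w F' : linear_forest e F -> rotation e F v w F' ->
  linear_forest e F' /\ exists u, [/\ e v u, adj F u w, v != w -> ~~ adj F u v &
    forall x y, adj F' x y = ([set x; y] == [set u; v]) ||
                             ([set x; y] != [set u; w]) && adj F x y].
Proof.
move=> lF [u [vE vu uw dist [lF' EF']]]; split=> //; exists u; split=> //.
  move=> vw; apply/negP => /(adj_path_dist lF)[p [pF up vp d1]].
  have := dist p pF up vp; rewrite d1 ltnS leqn0 /path_dist => d0.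
  have iwv : index w p = index v p by move: d0; lia.
  have wp : w \in p by rewrite -index_mem iwv index_mem.
  by case/eqP: vw; rewrite -(nth_index v vp) -iwv nth_index.
by move=> x y; rewrite adj_edges EF' !inE adj_edges.
Qed.

End Rotations.

(** * Effect of a rotation on neighbourhoods and endpoints *)

Section Effects.

Variables (T : finType) (e : rel T).
Hypotheses (sym_e : symmetric e) (irr_e : irreflexive e).
Implicit Types (F G : path_system T) (u v w x y z : T) (K : {set T}).

(** If w = v nothing changes; otherwise v gains the neighbour u, w loses it, and
    u has w replaced by v. *)
Lemma rotation_nbrs F v w F' : linear_forest e F -> rotation e F v w F' ->
  (v = w -> forall z, nbrs F' z = nbrs F z) /\
  (v != w -> exists u,
    [/\ [/\ u != v, u != w & e v u],
        u \notin nbrs F v /\ nbrs F' v = u |: nbrs F v,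
        u \in nbrs F w /\ nbrs F' w = nbrs F w :\ u,
        [/\ v \notin nbrs F u, w \in nbrs F u & nbrs F' u = v |: nbrs F u :\ w] &
        forall z, z != u -> z != v -> z != w -> nbrs F' z = nbrs F z]).
Proof.
move=> lF rot; have [lF' [u [vu uw vw_uv adjF']]] := rotation_effect lF rot.
split=> [vw z|vw].
  apply/setP => y; rewrite !in_nbrs adjF' -vw; case: eqP => //= Ey.
  by rewrite adj_edges Ey -adj_edges vw uw.
have uNv : u != v by apply: contraTneq vu => ->; rewrite irr_e.
have uNw : u != w by apply: contraTneq uw => ->; have := nbrs_irr sym_e irr_e w lF; rewrite in_nbrs.
have uv := vw_uv vw; have vu' : ~~ adj F v u by rewrite adj_sym.
have wu : adj F w u by rewrite adj_sym.
have nF' z y : (y \in nbrs F' z) =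
    ((z == u) && (y == v) || (z == v) && (y == u)) ||
    ~~ ((z == u) && (y == w) || (z == w) && (y == u)) && adj F z y.
  by rewrite in_nbrs adjF' !eq_set2.
exists u; split=> //.
- split; first by rewrite in_nbrs.
  apply/setP => y; rewrite nF' !inE eqxx [v == u]eq_sym (negPf uNv) (negPf vw) /=.
  by [].
- split; first by rewrite in_nbrs.
  apply/setP => y; rewrite nF' !inE eqxx [w == u]eq_sym (negPf uNw) [w == v]eq_sym (negPf vw) /=.
  by [].
- split; rewrite ?in_nbrs //.
  apply/setP => y; rewrite nF' !inE eqxx (negPf uNv) (negPf uNw) /= !orbF.
  by [].
move=> z /negPf zu /negPf zv /negPf zw.
by apply/setP => y; rewrite nF' in_nbrs zu zv zw.
Qed.

(** The number of neighbours in a set K containing v and w is preserved, also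
    at the pivot, except at v and w. *)
Lemma rotation_nbrs_meet F v w F' K z : linear_forest e F ->
  rotation e F v w F' -> v \in K -> w \in K -> z != v -> z != w ->
  #|nbrs F' z :&: K| = #|nbrs F z :&: K|.
Proof.
move=> lF rot vK wK zv zw; have [H1 H2] := rotation_nbrs lF rot.
have [/H1->//|/H2[u [_ _ _ [vu wu Eu] Ez]]] := eqVneq v w.
have [->|zu] := eqVneq z u; last by rewrite Ez.
have -> : nbrs F' u :&: K = v |: ((nbrs F u :&: K) :\ w).
  by apply/setP => y; rewrite Eu !inE; case: eqP => [->|_] //=; rewrite andbA.
rewrite cardsU1 [in RHS](cardsD1 w) !inE wK /=.
rewrite !in_nbrs in wu vu; rewrite wu /=.
by rewrite (negPf vu) /= andbF.
Qed.

Lemma rotation_nbrs_meet_le F v w F' K z : linear_forest e F ->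
  rotation e F v w F' -> v \in K -> w \in K -> z != v ->
  #|nbrs F' z :&: K| <= #|nbrs F z :&: K|.
Proof.
move=> lF rot vK wK zv; have [zw|zw] := eqVneq z w; last first.
  by rewrite (rotation_nbrs_meet lF rot).
have [H1 H2] := rotation_nbrs lF rot.
have [/H1->//|/H2[u [_ _ [_ Ew] _ _]]] := eqVneq v w.
by rewrite zw Ew subset_leq_card // setSI // subsetDl.
Qed.

Lemma rotation_linear F v w F' : rotation e F v w F' -> linear_forest e F'.
Proof. by case=> u [_ _ _ _ []]. Qed.

(** End(F') = (End(F) \ {v}) + {w}, without truncated subtraction. *)
Lemma rotation_End F v w F' z : linear_forest e F -> rotation e F v w F' ->
  End F' z + (z == v) = End F z + (z == w).
Proof.
move=> lF rot; have [H1 H2] := rotation_nbrs lF rot.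
have D := degree_End z lF; have D' := degree_End z (rotation_linear rot).
have [vw|vw] := eqVneq v w; first by rewrite vw; move: D D'; rewrite H1 //; lia.
have [u [[uv uw _] [nuv Ev] [nuw Ew] _ _]] := H2 vw.
have [zv|zv] := eqVneq z v.
  by move: D D'; rewrite zv Ev cardsU1 nuv (negPf vw) /=; lia.
have [zw|zw] := eqVneq z w.
  by move: D D'; rewrite zw Ew [#|nbrs F w|](cardsD1 u) nuw /=; lia.
have := rotation_nbrs_meet lF rot (in_setT v) (in_setT w) zv zw.
by rewrite !setIT; move: D D'; lia.
Qed.

End Effects.

Section MsetSize.

Variable T : finType.
Implicit Types A B : {mset T}%mset.

Lemma size_mset_sum A : size A = \sum_x A x.
Proof.
rewrite (eq_bigr (fun x => count_mem x A)); last by move=> x _; rewrite count_mem_mset.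
elim: (enum_mset A) => [|y s IH] /=; first by rewrite big1.
rewrite big_split /= -IH (bigD1 y) //= eqxx big1 // => x xy.
by rewrite eq_sym (negPf xy).
Qed.

Lemma size_msetD A B : size (A `+` B)%mset = size A + size B.
Proof.
rewrite !size_mset_sum -big_split /=.
by apply: eq_bigr => x _; rewrite msetE2.
Qed.

Lemma size_msetB A B : (B `<=` A)%mset -> size (A `\` B)%mset + size B = size A.
Proof. by move=> BA; rewrite -size_msetD msetBDK. Qed.

Lemma size_mset1 x : size (msetn 1 x : {mset T}%mset) = 1.
Proof. by rewrite enum_msetn size_nseq. Qed.

End MsetSize.

(** * Reachable forests and their free endpoints *)

Section Reachable.

Variables (T : finType) (e : rel T).
Hypotheses (sym_e : symmetric e) (irr_e : irreflexive e).
Implicit Types (F G : path_system T) (u v w x y z : T) (X Y : {mset T}%mset).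

Lemma mem_C F X v :
  v \in C e F X <-> exists2 G, rotations e F X G & X v < End G v.
Proof.
rewrite in_set; split=> [/asboolP[G RG]|[G RG vG]].
  by rewrite in_msetB => vG; exists G.
by apply/asboolP; exists G; rewrite ?in_msetB.
Qed.

Lemma rotations_step_lt F X G v w G' : rotations e F X G -> X v < End G v ->
  rotation e G v w G' -> rotations e F X G'.
Proof. by move=> RG vG; apply: rotations_step RG _; rewrite in_msetB. Qed.

Lemma rotations_trans F G H X Y : rotations e F X G ->
  rotations e G (X `+` Y)%mset H -> rotations e F X H.
Proof.
move=> RG; elim=> // {H} G1 v w G2 _ RG1; rewrite in_msetB msetE2 => vG1.
by apply: rotations_step_lt RG1 _; apply: leq_ltn_trans vG1; rewrite leq_addr.
Qed.

Lemma rotations_inv F X G : min_linear_forest e F -> (X `<=` End F)%mset ->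
  rotations e F X G -> min_linear_forest e G /\ (X `<=` End G)%mset.
Proof.
move=> mF XF; elim=> // {G} G1 v w G2 _ [[lG1 minG1] XG1].
rewrite in_msetB => vG1 rot; have lG2 := rotation_linear rot.
have E2 z := rotation_End sym_e irr_e z lG1 rot.
split; last first.
  apply/msubsetP => z; have := E2 z; have := msubsetP XG1 z; move: vG1.
  by case: (z =P v) => [->|_]; case: (z == w); lia.
split=> // G lG; apply: leq_trans (minG1 _ lG).
have : size (End G2) = size (End G1).
  have : size (End G2) + \sum_z (z == v) = size (End G1) + \sum_z (z == w).
    by rewrite !size_mset_sum -!big_split; apply: eq_bigr => z _ /=; rewrite E2.
  have sum1 (a : T) : \sum_z (z == a) = 1.
    by rewrite (bigD1 a) //= eqxx big1 // => z /negPf->.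
  by rewrite !sum1; lia.
by rewrite (size_End lG2) (size_End lG1); lia.
Qed.

(** All reachable forests have equally many endpoints, so fixing Y lowers the
    number of free endpoints by the size of Y. *)
Lemma size_free F X G : min_linear_forest e F -> (X `<=` End F)%mset ->
  rotations e F X G ->
  forall Y, (X `+` Y `<=` End G)%mset ->
  size (End G `\` (X `+` Y))%mset + size Y = size (End F `\` X)%mset.
Proof.
move=> mF XF RG Y XYG; have [mG XG] := rotations_inv mF XF RG.
have sFG : size F = size G.
  case: mF mG => lF mF [lG mG]; apply/eqP.
  by rewrite eqn_leq mF // mG.
have := size_msetB XYG; have := size_msetB XF; rewrite size_msetD.
by rewrite (size_End mF.1) (size_End mG.1) sFG; lia.
Qed.

Section Core.

Variables (F : path_system T) (X : {mset T}%mset).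
Hypotheses (mF : min_linear_forest e F) (XF : (X `<=` End F)%mset).

Local Notation R := (rotations e F X).
Local Notation K := (C e F X).

(** The number of graph neighbours of u in C(F, X). *)
Definition cdeg u := #|[set y | e u y] :&: K|.

Lemma in_nbrsC u y : (y \in [set y | e u y] :&: K) = e u y && (y \in K).
Proof. by rewrite in_setI; congr (_ && _); rewrite inE. Qed.

(** The number of neighbours of u in the forest G that lie in C(F, X). *)
Definition fdeg G u := #|nbrs G u :&: K|.

Lemma reach_linear G : R G -> linear_forest e G.
Proof. by move=> RG; have [[]] := rotations_inv mF XF RG. Qed.

Lemma free_C G v : R G -> X v < End G v -> v \in K.
Proof. by move=> RG vG; apply/mem_C; exists G. Qed.

Lemma reach_step G v w G' : R G -> X v < End G v -> rotation e G v w G' ->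
  [/\ R G', v \in K, w \in K & X w < End G' w].
Proof.
move=> RG vG rot; have RG' := rotations_step_lt RG vG rot.
have wG' : X w < End G' w.
  have [_ /msubsetP/(_ w) XG] := rotations_inv mF XF RG.
  have := rotation_End sym_e irr_e w (reach_linear RG) rot.
  by rewrite eqxx; case: (w =P v) => [->|_]; lia.
by split=> //; [apply: free_C vG | apply: free_C wG'].
Qed.

Lemma pivot_fdeg G u v : R G -> X v < End G v -> e v u -> 0 < fdeg G u.
Proof.
move=> RG vG vu; have [mG _] := rotations_inv mF XF RG.
have vE : v \in End G by rewrite in_mset; lia.
have [w [G' [rot uw]]] := rotate_end sym_e irr_e mG vE vu.
have [_ _ wK _] := reach_step RG vG rot.
by apply/card_gt0P; exists w; rewrite in_setI in_nbrs uw.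
Qed.

(** If two free endpoints are adjacent to u, both neighbours of u in G become
    endpoints, so they lie in C(F, X). *)
Lemma pivot_two_free G u x y : R G -> X x < End G x -> X y < End G y ->
  (x = y -> (X x).+1 < End G x) -> e x u -> e y u ->
  fdeg G u = 2 /\ End G u = 0.
Proof.
move=> RG xG yG xyG xu yu; have [mG _] := rotations_inv mF XF RG.
have lG := reach_linear RG.
have [||xy|deg2 rot] := rotate_two_ends sym_e irr_e mG _ _ _ xu yu.
- by lia.
- by lia.
- by have := xyG xy; lia.
split; last by have := degree_End u lG; rewrite deg2; lia.
rewrite -deg2 /fdeg; congr #|_ : {set T}|; apply/setIidPl/subsetP => w.
rewrite in_nbrs => /rot[z [G' [zxy rotz]]].
have zG : X z < End G z by move: zxy; rewrite !inE => /orP[]/eqP->.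
by have [] := reach_step RG zG rotz.
Qed.

Lemma fdeg_step G v w G' z : R G -> X v < End G v -> rotation e G v w G' ->
  z != v -> z != w -> fdeg G' z = fdeg G z.
Proof.
move=> RG vG rot; have [_ vK wK _] := reach_step RG vG rot.
exact: (rotation_nbrs_meet sym_e irr_e (reach_linear RG) rot vK wK).
Qed.

Lemma fdeg_step_le G v w G' z : R G -> X v < End G v -> rotation e G v w G' ->
  z != v -> fdeg G' z <= fdeg G z.
Proof.
move=> RG vG rot; have [_ vK wK _] := reach_step RG vG rot.
exact: (rotation_nbrs_meet_le sym_e irr_e (reach_linear RG) rot vK wK).
Qed.

(** A vertex outside C(F, X) is never the old or new endpoint of a rotation;
    as a pivot it exchanges one neighbour in C(F, X) for another. *)
Lemma fdeg_outside G b : b \notin K -> R G -> fdeg G b = fdeg F b.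
Proof.
move=> bK; elim=> // {G} G v w G' RG IH; rewrite in_msetB => vG rot.
have [_ vK wK _] := reach_step RG vG rot; rewrite -IH.
by apply: (fdeg_step RG vG rot); apply: contraNneq bK => ->.
Qed.

(** Before a neighbour of x becomes free, [fdeg _ x] must become positive; as
    long as it is 0, x cannot be a pivot and no neighbour of x can be an endpoint
    of a rotation, so the change is a rotation of x itself. *)
Lemma fdeg_isolated x : x \in K -> fdeg F x = 0 -> 0 < cdeg x ->
  exists G, [/\ R G, X x < End G x, fdeg G x = 0 &
     forall v, v \in K -> e x v -> fdeg G v = fdeg F v].
Proof.
move=> xK x0 /card_gt0P[v0]; rewrite in_nbrsC => /andP[xv0 v0K].
set goal := exists G, _.
have key G : R G -> goal \/
   (fdeg G x = 0 /\ forall v, v \in K -> e x v -> fdeg G v = fdeg F v).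
  elim=> [|{}G v w G' RG IH]; first by right.
  rewrite in_msetB => vG rot; case: IH => [|[Gx0 Gconst]]; first by left.
  have [xv|xv] := eqVneq x v; first left.
    by exists G; rewrite xv in Gx0 *; split=> // z; rewrite -xv; apply: Gconst.
  right; have [RG' vK wK wG'] := reach_step RG vG rot.
  have G'x0 : fdeg G' x = 0.
    by apply/eqP; rewrite -leqn0 -Gx0 (fdeg_step_le RG vG rot).
  split=> // z zK xz; rewrite -Gconst //; apply: (fdeg_step RG vG rot).
    apply: contraTneq xz => ->; rewrite sym_e; apply/negP => vx.
    by have := pivot_fdeg RG vG vx; rewrite Gx0.
  apply: contraTneq xz => ->; rewrite sym_e; apply/negP => wx.
  by have := pivot_fdeg RG' wG' wx; rewrite G'x0.
have [G RG v0G] := (mem_C F X v0).1 v0K.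
have [//|[Gx0 _]] := key G RG.
have v0x : e v0 x by rewrite sym_e.
by have := pivot_fdeg RG v0G v0x; rewrite Gx0.
Qed.

(** * Degree bounds in a smallest counterexample *)

Section Drop.

Variable d : nat.
Hypotheses (reg : regular e d).
Hypothesis IH : forall G Y, min_linear_forest e G -> (Y `<=` End G)%mset ->
  size (End G `\` Y)%mset < size (End F `\` X)%mset ->
  d.+1 * size (End G `\` Y)%mset <= 4 * #|C e G Y|.
Hypothesis small : 4 * #|K| < d.+1 * size (End F `\` X)%mset.

(** Fixing Y removes the vertices of N, and by induction the remaining ones are
    enough for the other free endpoints. *)
Lemma drop G Y (N : {set T}) : R G -> (X `+` Y `<=` End G)%mset ->
  0 < size Y -> N \subset K -> [disjoint N & C e G (X `+` Y)%mset] ->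
  4 * #|N| < d.+1 * size Y.
Proof.
move=> RG XYG Y0 NK dis; have sz := size_free mF XF RG XYG.
have [mG _] := rotations_inv mF XF RG.
have lt : size (End G `\` (X `+` Y))%mset < size (End F `\` X)%mset by lia.
have IHG := IH mG XYG lt.
have sub : C e G (X `+` Y)%mset \subset K.
  apply/subsetP => v /mem_C[H RH vH]; apply/mem_C; exists H.
    exact: rotations_trans RG RH.
  by apply: leq_ltn_trans vH; rewrite msetE2 leq_addr.
have : #|N| + #|C e G (X `+` Y)%mset| <= #|K|.
  have := leq_card_setU N (C e G (X `+` Y)%mset).
  by rewrite dis => -[_ /eqP <-]; rewrite subset_leq_card // subUset NK.
move: small IHG; rewrite -sz mulnDr; lia.
Qed.

Lemma cdeg_outside b : b \notin K -> 2 * cdeg b <= d * fdeg F b.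
Proof.
move=> bK; have cd : cdeg b <= d.
  by rewrite -(reg b) subset_leq_card // subsetIl.
have [c0|] := posnP (cdeg b); first by rewrite c0.
move/card_gt0P => [x]; rewrite in_nbrsC => /andP[bx xK].
have [G RG xG] := (mem_C F X x).1 xK.
have xb : e x b by rewrite sym_e.
have := pivot_fdeg RG xG xb; rewrite (fdeg_outside bK RG) => f0.
have [f2|f1] := leqP 2 (fdeg F b); first by nia.
have {f0}f1 : fdeg F b = 1 by lia.
suff : 4 * cdeg b < d.+1 * size (msetn 1 x : {mset T}%mset).
  by rewrite size_mset1 f1; lia.
have XxG : (X `+` msetn 1 x `<=` End G)%mset.
  apply/msubsetP => z; rewrite msetE2 msetnE.
  have [_ /msubsetP/(_ z)] := rotations_inv mF XF RG.
  by case: (z =P x) => [->|_]; lia.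
apply: (drop RG XxG); rewrite ?size_mset1 ?subsetIr //.
rewrite disjoint_subset; apply/subsetP => y; rewrite in_nbrsC => /andP[by_ yK].
rewrite inE; apply/negP => /mem_C[H RH]; rewrite msetE2 msetnE => yH.
have RFH := rotations_trans RG RH.
have [_ /msubsetP/(_ x)] := rotations_inv (rotations_inv mF XF RG).1 XxG RH.
rewrite msetE2 msetnxx addn1 => xH.
have yb : e y b by rewrite sym_e.
have yH' : X y < End H y by lia.
have xyH : x = y -> (X x).+1 < End H x by move=> E; move: yH; rewrite -E eqxx; lia.
have [] := pivot_two_free RFH xH yH' xyH xb yb.
by rewrite (fdeg_outside bK RFH) f1.
Qed.

Lemma msub_fix Y G z : (Y `<=` End G)%mset -> Y z < End G z ->
  (Y `+` msetn 1 z `<=` End G)%mset.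
Proof.
move=> /msubsetP YG zG; apply/msubsetP => y; rewrite msetE2 msetnE.
by have := YG y; case: (y =P z) => [->|_]; lia.
Qed.

Lemma cdeg_inside u : u \in K -> 2 * cdeg u <= d.
Proof.
move=> uK; have [G RG uG] := (mem_C F X u).1 uK.
have [mG XG] := rotations_inv mF XF RG; have XuG := msub_fix XG uG.
have [dis|] := boolP [disjoint [set y | e u y] :&: K & C e G (X `+` msetn 1 u)%mset].
  by have := drop RG XuG _ (subsetIr _ _) dis; rewrite size_mset1 /cdeg; lia.
rewrite -setI_eq0 => /set0Pn[y]; rewrite in_setI in_nbrsC => /andP[/andP[uy _]].
move=> /mem_C[H RH yH]; have RFH := rotations_trans RG RH.
have [mH XuH] := rotations_inv mG XuG RH; have XuyH := msub_fix XuH yH.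
have XYH : (X `+` (msetn 1 u `+` msetn 1 y) `<=` End H)%mset by rewrite msetDA.
(* With u and y fixed, a free neighbour z of u would make u a pivot for y and z,
   but u is an endpoint. *)
suff dis : [disjoint [set y | e u y] :&: K &
                     C e H (X `+` (msetn 1 u `+` msetn 1 y))%mset].
  by have := drop RFH XYH _ (subsetIr _ _) dis; rewrite size_msetD !size_mset1 /cdeg; lia.
rewrite -setI_eq0; apply/set0Pn => -[z]; rewrite in_setI in_nbrsC.
move=> /andP[/andP[uz _]] /mem_C[L RL zL]; have RFL := rotations_trans RFH RL.
have [_ /msubsetP XYL] := rotations_inv mH XYH RL.
have := XYL y; have := XYL u; move: zL; rewrite !msetE2 !msetnE !eqxx => zL uL yL.
have [||yz|||_ uL0] := @pivot_two_free L u y z RFL.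
- by lia.
- by lia.
- by move: zL; rewrite -yz eqxx; lia.
- by rewrite sym_e.
- by rewrite sym_e.
- by lia.
Qed.

Lemma fdeg_isolated_nbr x v : x \in K -> fdeg F x = 0 -> v \in K -> e x v ->
  0 < fdeg F v.
Proof.
move=> xK x0 vK xv; have cx : 0 < cdeg x.
  by apply/card_gt0P; exists v; rewrite in_nbrsC xv.
have [G [RG xG _ Gconst]] := fdeg_isolated xK x0 cx.
by rewrite -Gconst //; apply: pivot_fdeg RG xG xv.
Qed.

(** Once x is free with [fdeg _ x] = 0 and is fixed, both [fdeg _ x] = 0 and
    [fdeg _ v] = 1 persist: any second free endpoint adjacent to v would force
    [fdeg _ v] = 2, so no other neighbour of v ever becomes free. *)
Lemma cdeg_isolated_nbr x v : x \in K -> fdeg F x = 0 -> v \in K -> e x v ->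
  fdeg F v = 1 -> 4 * cdeg v <= d.
Proof.
move=> xK x0 vK xv v1; have cx : 0 < cdeg x.
  by apply/card_gt0P; exists v; rewrite in_nbrsC xv.
have [G [RG xG Gx0 Gconst]] := fdeg_isolated xK x0 cx.
have [mG XG] := rotations_inv mF XF RG; have XxG := msub_fix XG xG.
have Gv1 : fdeg G v = 1 by rewrite Gconst.
(* No neighbour y of v is free besides the fixed copy of x. *)
have two H y : rotations e G (X `+` msetn 1 x)%mset H -> fdeg H v = 1 ->
    (X `+` msetn 1 x)%mset y < End H y -> e y v -> False.
  move=> RH Hv1; rewrite msetE2 msetnE => yH yv.
  have [_ /msubsetP/(_ x)] := rotations_inv mG XxG RH.
  rewrite msetE2 msetnxx => xH.
  have [||xy|Hv2 _] := @pivot_two_free H v x y (rotations_trans RG RH) _ _ _ xv yv.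
  - by lia.
  - by lia.
  - by move: yH; rewrite -xy eqxx; lia.
  - by rewrite Hv1 in Hv2.
have inv H : rotations e G (X `+` msetn 1 x)%mset H -> fdeg H x = 0 /\ fdeg H v = 1.
  elim=> // {H} H a w H' RH [Hx0 Hv1]; rewrite in_msetB => aH' rot.
  have RFH := rotations_trans RG RH.
  have aH : X a < End H a.
    by apply: leq_ltn_trans aH'; rewrite msetE2 leq_addr.
  have xa : x != a.
    by apply/eqP => xa; apply: (two H a) => //; rewrite -xa.
  have [RFH' aK wK wH'] := reach_step RFH aH rot.
  have H'x0 : fdeg H' x = 0.
    by apply/eqP; rewrite -leqn0 -Hx0 (fdeg_step_le RFH aH rot).
  split=> //; rewrite -Hv1; apply: (fdeg_step RFH aH rot).
    apply: contraTneq xv => ->; rewrite sym_e; apply/negP => ax.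
    by have := pivot_fdeg RFH aH ax; rewrite Hx0.
  apply: contraTneq xv => ->; rewrite sym_e; apply/negP => wx.
  by have := pivot_fdeg RFH' wH' wx; rewrite H'x0.
suff dis : [disjoint [set y | e v y] :&: K & C e G (X `+` msetn 1 x)%mset].
  by have := drop RG XxG _ (subsetIr _ _) dis; rewrite size_mset1 /cdeg; lia.
rewrite -setI_eq0; apply/set0Pn => -[y]; rewrite in_setI in_nbrsC.
move=> /andP[/andP[vy _]] /mem_C[H RH yH].
by apply: (two H y RH _ yH); [case: (inv H RH) | rewrite sym_e].
Qed.

(** * Counting *)

Lemma double_count (r : rel T) (A B : {set T}) : symmetric r ->
  \sum_(x in A) #|[set y | r x y] :&: B| = \sum_(y in B) #|[set x | r y x] :&: A|.
Proof.
move=> sr; have E (a : T) (D : {set T}) : #|[set y | r a y] :&: D| = \sum_(y in D) r a y.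
  rewrite -sum1_card big_mkcond [RHS]big_mkcond; apply: eq_bigr => y _.
  by rewrite !inE; case: (r a y); case: (y \in D).
under eq_bigr => x _ do rewrite E; under [RHS]eq_bigr => y _ do rewrite E.
rewrite exchange_big; apply: eq_bigr => y _; apply: eq_bigr => x _.
by rewrite sr.
Qed.

Lemma sum_cdeg : \sum_u cdeg u = d * #|K|.
Proof.
have := double_count setT K sym_e; rewrite (eq_bigl xpredT) => [->|u]; last by rewrite inE.
rewrite mulnC -sum_nat_const; apply: eq_bigr => y _.
by rewrite setIT.
Qed.

Lemma sum_fdeg : \sum_u fdeg F u + \sum_(y in K) End F y = 2 * #|K|.
Proof.
have := double_count setT K (adj_sym F); rewrite (eq_bigl xpredT) => [|u]; last by rewrite inE.
rewrite /fdeg /nbrs => ->; rewrite mulnC -sum_nat_const -big_split /=.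
apply: eq_bigr => y _; rewrite setIT; exact: degree_End mF.1.
Qed.

Lemma sum_End_ge : size (End F `\` X)%mset <= \sum_(y in K) End F y.
Proof.
rewrite size_mset_sum (bigID (mem K)) /= [X in _ + X]big1 ?addn0.
  by apply: leq_sum => y _; rewrite msetE2 leq_subr.
move=> y yK; rewrite msetE2; apply/eqP; rewrite -leqn0 leqNgt; apply: contra yK.
by rewrite lt0n subn_eq0 -ltnNge; apply: free_C; apply: rotations_refl.
Qed.

(** Each vertex u of C(F, X) that is not K-isolated also pays for its
    K-isolated neighbours: 2 cdeg u + 2 ideg u <= d fdeg F u, where ideg u counts them. *)
Lemma sum_cdeg_le : 2 * \sum_u cdeg u <= d * \sum_u fdeg F u.
Proof.
(* I is the set of K-isolated vertices. *)
pose I := [set x in K | fdeg F x == 0].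
have inI x : (x \in I) = (x \in K) && (fdeg F x == 0) by rewrite in_set.
pose ideg u := #|[set y | e u y] :&: I|.
have ideg_le u : ideg u <= cdeg u.
  by apply/subset_leq_card/setIS/subsetP => x; rewrite inI => /andP[].
have inideg u x : (x \in [set y | e u y] :&: I) = e u x && (x \in I).
  by rewrite in_setI; congr (_ && _); rewrite inE.
have ideg0 u : u \in I -> ideg u = 0.
  rewrite inI => /andP[uK /eqP u0]; apply/eqP; rewrite cards_eq0.
  apply/set0Pn => -[x]; rewrite inideg inI => /and3P[ux xK x0].
  by have := fdeg_isolated_nbr uK u0 xK ux; rewrite (eqP x0).
have sumI : \sum_(u in I) cdeg u = \sum_(u in K) ideg u := double_count I K sym_e.
have bound u : 2 * (if u \in I then 0 else cdeg u) +
               2 * (if u \in K then ideg u else 0) <= d * fdeg F u.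
  have [uK|uK] := boolP (u \in K); last first.
    have -> : u \in I = false by rewrite inI (negPf uK).
    by rewrite muln0 addn0; apply: cdeg_outside.
  have [uI|uI] := boolP (u \in I); first by rewrite ideg0.
  have := cdeg_inside uK; have := ideg_le u.
  have : 0 < fdeg F u by move: uI; rewrite inI uK lt0n.
  have [f2|f1] := leqP 2 (fdeg F u); first by nia.
  move=> f0; have {f0}f1 : fdeg F u = 1 by lia.
  have [->|/card_gt0P[x]] := posnP (ideg u); first by rewrite f1; lia.
  rewrite inideg inI => /and3P[ux xK /eqP x0].
  have := cdeg_isolated_nbr xK x0 uK; rewrite sym_e => /(_ ux f1).
  by rewrite f1; lia.
have sub_I : \sum_(u in I) cdeg u = \sum_u (if u \in I then cdeg u else 0).
  by rewrite [LHS]big_mkcond.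
have -> : \sum_u cdeg u = \sum_u (if u \in I then 0 else cdeg u) +
                          \sum_u (if u \in K then ideg u else 0).
  rewrite -[X in _ + X]big_mkcond -sumI sub_I -big_split /=.
  by apply: eq_bigr => u _; case: ifP; rewrite ?addn0.
rewrite mulnDr !big_distrr -big_split /=.
by apply: leq_sum => u _; apply: bound.
Qed.

Lemma small_absurd : False.
Proof.
have := sum_cdeg_le; rewrite sum_cdeg; have := sum_fdeg; have := sum_End_ge.
move: small; set k := size _; set S := \sum_(y in K) _; set f := \sum_u _.
have [->|d0] := posnP d; first by lia.
move: (#|K|) => c sm kS fS le; have k0 : 0 < k by case: (k) sm => //; lia.
have : d * f < d * (2 * c) by rewrite ltn_pmul2l //; lia.
by lia.
Qed.

End Drop.
End Core.
End Reachable.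

(** The bound in integer form. *)
Lemma C_lower_bound (T : finType) (e : rel T) (d : nat) (F : path_system T)
    (X : {mset T}%mset) :
  simple_graph e -> regular e d -> min_linear_forest e F ->
  (X `<=` End F)%mset ->
  d.+1 * size (End F `\` X)%mset <= 4 * #|C e F X|.
Proof.
move=> [sym_e irr_e] reg.
have [n] := ubnP (size (End F `\` X)%mset).
elim: n F X => // n IH F X le_n mF XF; rewrite leqNgt; apply/negP => small.
apply: (small_absurd sym_e irr_e mF XF reg) small => G Y mG YG lt.
by apply: IH => //; apply: leq_trans lt _.
Qed.

Import GRing.Theory Num.Theory.

Theorem lemma2p3 (T : finType) (e : rel T) (d : nat) (F : path_system T)
    (X : {mset T}%mset) :
  simple_graph e -> regular e d -> min_linear_forest e F ->
  (X `<=` End F)%mset ->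
  ((d%:R + 1) / 4%:R * (size (End F `\` X)%mset)%:R
     <= (#|C e F X|)%:R :> rat)%R.
Proof.
move=> simple reg mF XF; have := C_lower_bound simple reg mF XF.
rewrite -(ler_nat rat) !natrM -natr1 => bound.
by rewrite mulrAC ler_pdivrMr ?ltr0n // [X in (_ <= X)%R]mulrC.
Qed.
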